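(* Let $X$ be a metric space that admits a bi-Lipschitz triangulation. Then $X$ is cube-decomposable.
   Context: A (simplicial) complex $K$ is a collection of open nondegenerate simplices in some $\mathbb{R}^D$ such that (1) every face of a simplex of $K$ is in $K$; (2) the intersection of two closed simplices of $K$ is either empty or a face of each of them; (3) each point of $|K|:=\bigcup_{S\in K}S$ has a neighbourhood meeting only finitely many simplices of $K$. For connected $K$, define the metric $\rho_K$ on $|K|$ as follows. Let $\Delta^m$ be the open regular $m$-simplex with unit edge length in $\mathbb{R}^m$ with the Euclidean metric. For $S\in K$ of dimension $m$, with affine parametrisation $F\colon\overline{\Delta}^m\to\overline{S}$, put $\rho_S(F(x),F(y)):=|x-y|$ (these agree on common faces). Then $\rho_K(x,y):=\inf\sum_{j=0}^{n-1}\rho_{S_j}(x_j,x_{j+1})$, the infimum over all finite chains $x=x_0,\dots,x_n=y$ in $|K|$ such that $x_j,x_{j+1}$ lie in a common closed simplex $\overline{S}_j$ with $S_j\in K$. A bi-Lipschitz triangulation of a metric space $(X,\rho)$ is a surjective map $\tau\colon(|K|,\rho_K)\to(X,\rho)$, with $K$ a connected simplicial complex, such that for some $L$ one has $L^{-1}\rho_K(p,q)\le\rho(\tau(p),\tau(q))\le L\rho_K(p,q)$ for all $p,q\in|K|$. $B(x,R)$ denotes the open ball. A family of dyadic cubes of a metric space $(X,\rho)$ is a collection of subsets $Q_\alpha^k\subset X$, $k\in\mathbb{N}_0$, $\alpha\in I_k$ ($I_k$ index sets), for which there exist a ball constant $C>0$ and a scaling value $\delta\in(0,1)$ such that: (a)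 $X=\bigsqcup_{\alpha\in I_k}Q_\alpha^k$ for each $k\in\mathbb{N}_0$; (b) for each $l\ge k$, $\alpha\in I_l$, $\beta\in I_k$, either $Q_\alpha^l\subset Q_\beta^k$ or $Q_\alpha^l\cap Q_\beta^k=\emptyset$; (c) for each $Q_\alpha^k$ there is a point $x_\alpha^k\in Q_\alpha^k$ with $B(x_\alpha^k,C^{-1}\delta^k)\subseteq Q_\alpha^k\subseteq B(x_\alpha^k,C\delta^k)$. The family is connected if, in addition, (d) each $Q_\alpha^k$ is a connected subset of $X$. $X$ is cube-decomposable if it has a connected family of dyadic cubes. *)

(* Defs.v *)
From HB Require Import structures.
From mathcomp Require Import all_boot all_order all_algebra.
From mathcomp Require Import all_classical all_reals all_analysis.

Set Implicit Arguments.
Unset Strict Implicit.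
Unset Printing Implicit Defensive.

Import Order.TTheory GRing.Theory Num.Theory.
Import numFieldNormedType.Exports.

Local Open Scope classical_set_scope.
Local Open Scope ring_scope.

Section Simplices.
Context {R : realType}.

(* The norm `|x| of the library on 'rV[R]_n is the sup norm; the topology is the
   same. *)
Definition enorm n (x : 'rV[R]_n) : R := Num.sqrt (\sum_(i < n) x ord0 i ^+ 2).

Definition affinely_independent D m (v : 'I_m.+1 -> 'rV[R]_D) : Prop :=
  free [tuple v (lift ord0 i) - v ord0 | i < m].

Definition open_simplex D m (v : 'I_m.+1 -> 'rV[R]_D) : set 'rV[R]_D :=
  [set x | exists a : 'I_m.+1 -> R,
    [/\ forall i, 0 < a i, \sum_(i < m.+1) a i = 1
      & x = \sum_(i < m.+1) a i *: v i]].

Definition is_simplex D (S : set 'rV[R]_D) : Prop :=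
  exists (m : nat) (v : 'I_m.+1 -> 'rV[R]_D),
    affinely_independent v /\ S = open_simplex v.

(* A face is again an open simplex, spanned by a nonempty subfamily of the
   vertices; S is a face of itself.  The corresponding closed face is
   [closure T]. *)
Definition is_face D (T S : set 'rV[R]_D) : Prop :=
  exists (m : nat) (v : 'I_m.+1 -> 'rV[R]_D) (l : nat)
         (f : 'I_l.+1 -> 'I_m.+1),
    [/\ affinely_independent v, S = open_simplex v, injective f
      & T = open_simplex (v \o f)].

Definition polyhedron D (K : set (set 'rV[R]_D)) : set 'rV[R]_D :=
  \bigcup_(S in K) S.

Record simplicial_complex D (K : set (set 'rV[R]_D)) : Prop := {
  complex_simplex : forall S, K S -> is_simplex S;
  complex_face : forall S T, K S -> is_face T S -> K T;
  complex_inter : forall S T, K S -> K T ->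
    closure S `&` closure T = set0 \/
    exists F, [/\ is_face F S, is_face F T
                & closure S `&` closure T = closure F];
  complex_locally_finite : forall x, polyhedron K x ->
    exists2 U, nbhs x U & finite_set [set S | K S /\ S `&` U !=set0] }.

Definition connected_complex D (K : set (set 'rV[R]_D)) : Prop :=
  connected (polyhedron K).

Definition regular_unit_simplex m (e : 'I_m.+1 -> 'rV[R]_m) : Prop :=
  forall i j, i != j -> enorm (e i - e j) = 1.

(* [x |-> x *m A + b] is an affine parametrisation of the closed simplex
   [closure S] by the closed regular simplex with vertices [e]. *)
Definition affine_parametrisation D m (e : 'I_m.+1 -> 'rV[R]_m)
    (A : 'M[R]_(m, D)) (b : 'rV[R]_D) (S : set 'rV[R]_D) : Prop :=
  regular_unit_simplex e /\
  set_bij (closure (open_simplex e)) (closure S) (fun x => x *m A + b).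

(* For a simplex S and x, y in [closure S] the set below is a singleton, because
   two affine parametrisations of the same simplex differ by an isometry. *)
Definition simplex_dist D (S : set 'rV[R]_D) (x y : 'rV[R]_D) : R :=
  xget 0 [set d | exists (m : nat) (e : 'I_m.+1 -> 'rV[R]_m)
                         (A : 'M[R]_(m, D)) (b : 'rV[R]_D) (p q : 'rV[R]_m),
    [/\ affine_parametrisation e A b S,
        closure (open_simplex e) p /\ x = p *m A + b,
        closure (open_simplex e) q /\ y = q *m A + b
      & d = enorm (p - q)]].

(* Only the points 0, ..., n of p and the simplices 0, ..., n - 1 of S matter. *)
Definition is_chain D (K : set (set 'rV[R]_D)) (x y : 'rV[R]_D) (n : nat)
    (p : nat -> 'rV[R]_D) (S : nat -> set 'rV[R]_D) : Prop :=
  [/\ p 0%N = x, p n = y,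
      forall j, (j <= n)%N -> polyhedron K (p j)
    & forall j, (j < n)%N ->
        [/\ K (S j), closure (S j) (p j) & closure (S j) (p j.+1)]].

Definition complex_dist D (K : set (set 'rV[R]_D)) (x y : 'rV[R]_D) : R :=
  inf [set l | exists n p S, is_chain K x y n p S /\
                 l = \sum_(j < n) simplex_dist (S j) (p j) (p j.+1)].

End Simplices.

Section MetricSpaces.
Context {R : realType}.

Definition bilipschitz_triangulation (X : metricType R) D
    (K : set (set 'rV[R]_D)) (tau : polyhedron K -> X) : Prop :=
  [/\ simplicial_complex K, connected_complex K, (forall x, exists p, tau p = x)
    & exists2 L : R, 0 < L & forall p q : polyhedron K,
        L^-1 * complex_dist K (\val p) (\val q) <= mdist (tau p) (tau q) /\
        mdist (tau p) (tau q) <= L * complex_dist K (\val p) (\val q)].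

Definition admits_bilipschitz_triangulation (X : metricType R) : Prop :=
  exists (D : nat) (K : set (set 'rV[R]_D)) (tau : polyhedron K -> X),
    bilipschitz_triangulation tau.

Definition dyadic_cubes (X : metricType R) (I : nat -> Type)
    (Q : forall k, I k -> set X) : Prop :=
  exists C delta : R,
    [/\ 0 < C, 0 < delta < 1,
        forall k, \bigcup_(a in [set: I k]) Q k a = [set: X] /\
                  trivIset [set: I k] (Q k),
        forall k l (a : I l) (b : I k), (k <= l)%N ->
          Q l a `<=` Q k b \/ Q l a `&` Q k b = set0
      & forall k (a : I k), exists x : X,
          [/\ Q k a x, ball x (C^-1 * delta ^+ k) `<=` Q k a
            & Q k a `<=` ball x (C * delta ^+ k)]].

Definition connected_dyadic_cubes (X : metricType R) (I : nat -> Type)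
    (Q : forall k, I k -> set X) : Prop :=
  dyadic_cubes Q /\ forall k (a : I k), connected (Q k a).

Definition cube_decomposable (X : metricType R) : Prop :=
  exists (I : nat -> Type) (Q : forall k, I k -> set X),
    connected_dyadic_cubes Q.

End MetricSpaces.

(* Main.v *)
Require Import Defs.
From mathcomp Require Import all_boot all_order all_algebra.
From mathcomp Require Import all_classical all_reals all_analysis.
From mathcomp Require Import ring lra zify.

Set Implicit Arguments.
Unset Strict Implicit.
Unset Printing Implicit Defensive.

Import Order.TTheory GRing.Theory Num.Theory.
Import numFieldNormedType.Exports.

Local Open Scope classical_set_scope.
Local Open Scope ring_scope.

(* In barycentric coordinates the metric of the complex is comparable, inside every
   closed simplex, with the sup distance of the coordinates, and the coordinates are
   globally Lipschitz.  Every point x has a vertex v with the largest coordinate; with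
   y_w = x_w / x_v in [0, 1] the points with top vertex v form a union of cubes
   [0, 1]^sigma sharing the corner v, one for each simplex {v} u sigma.  The cube of
   generation k of x consists of the points with the same top vertex and the same
   dyadic intervals of length 2^-k containing the y_w.  These sets are nested.  The
   point c with y_w the midpoint of the interval of w, except y_w = 0 when that interval
   contains 0, lies in the cube and is connected to each of its points by a
   segment.  All the constraints hold at c with a margin of order 2^-k, also towards
   the simplices adjacent to c, whatever their number; so no bound on the local
   combinatorics is needed, only the bound D on the dimension. *)

(** * Dyadic cells in barycentric coordinates *)

Section DyadicCode.
Context {R : realType}.
Implicit Types (k j : nat) (y a b : R).

(** The cap closes the last of the 2^k half-open intervals at 1, the value of the ratio at the top
    vertex itself. *)
Definition dyadic_code k y : nat := minn (Num.truncn (2 ^+ k * y)) (2 ^ k).-1.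

Lemma dyadic_code_lt k y : (dyadic_code k y < 2 ^ k)%N.
Proof.
by rewrite (leq_ltn_trans (geq_minr _ _))// prednK// expn_gt0.
Qed.

(** This is the source of nesting: truncation commutes with halving, and so does the cap, since half
    of 2^(k+1) - 1 rounds down to 2^k - 1. *)
Lemma dyadic_code_half k y : 0 <= y -> dyadic_code k y = (dyadic_code k.+1 y)./2.
Proof.
move=> y0; rewrite /dyadic_code.
have -> : Num.truncn (2 ^+ k * y) = (Num.truncn (2 ^+ k.+1 * y))./2.
  apply: truncn_def.
  have /truncn_itv : 0 <= 2 ^+ k.+1 * y
    by rewrite mulr_ge0// exprn_ge0.
  set n := Num.truncn _; rewrite exprS -mulrA => /andP[].
  move: (_ ^+ _ * _) => z n1 n2.
  have : n%:R = (odd n)%:R + 2 * n./2%:R :> R.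
    by rewrite -[in LHS](odd_double_half n) natrD -mul2n natrM.
  move: n1 n2; rewrite -!natr1.
  by case: (odd n) => /= n1 n2; rewrite ?mulr0n ?mulr1n => nE; apply/andP; split; lra.
have : (0 < 2 ^ k)%N by rewrite expn_gt0.
rewrite expnS; move: (Num.truncn _) (2 ^ k)%N => n p p0.
by lia.
Qed.

(** Because of the cap the upper bound is not strict: it is an equality for a = b. Clearing the
    denominator [b] makes both bounds linear in the coordinates. *)
Lemma dyadic_code_itv k a b : 0 <= a <= b -> 0 < b ->
  (dyadic_code k (a / b))%:R * b <= 2 ^+ k * a <= (dyadic_code k (a / b)).+1%:R * b.
Proof.
move=> /andP[a0 ab] b0.
rewrite -(ler_pdivlMr _ _ b0) -(ler_pdivrMr _ _ b0) -mulrA.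
have y0 : 0 <= a / b by rewrite divr_ge0// ltW.
have y1 : a / b <= 1 by rewrite ler_pdivrMr// mul1r.
move: (a / b) y0 y1 => y y0 y1.
have /truncn_itv/andP[] : 0 <= 2 ^+ k * y by rewrite mulr_ge0// exprn_ge0.
rewrite /dyadic_code; set n := Num.truncn _ => n1 n2.
rewrite /minn; case: ltnP => [_|le]; first by rewrite n1 ltW.
rewrite (le_trans _ n1) ?ler_nat//= prednK ?expn_gt0//.
by rewrite natrX ler_piMr// exprn_ge0.
Qed.

Lemma dyadic_code_eq k j a b : (j < 2 ^ k)%N -> 0 < b ->
  j%:R * b <= 2 ^+ k * a -> 2 ^+ k * a < j.+1%:R * b -> dyadic_code k (a / b) = j.
Proof.
move=> jk b0 ja aj.
rewrite /dyadic_code mulrA (@truncn_def _ _ j).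
  by rewrite /minn; case: ltnP => //; lia.
by rewrite ler_pdivlMr// ltr_pdivrMr// ja aj.
Qed.

End DyadicCode.

(** * Functions supported on a finite family of vertices *)

Section CarriedBy.
Context {V : eqType} {U : nmodType}.
Implicit Types f g : V -> U.

Definition carried_by m (v : 'I_m.+1 -> V) f : Prop :=
  forall w, (forall i, v i != w) -> f w = 0.

Lemma carried_by_ext m (v : 'I_m.+1 -> V) f g :
  carried_by v f -> carried_by v g -> (forall i, f (v i) = g (v i)) -> f = g.
Proof.
move=> cf cg fg; apply/funext => w.
have [[i <-]//|nw] := pselect (exists i, v i = w).
have vw i : v i != w by apply/eqP => vi; apply: nw; exists i.
by rewrite cf// cg.
Qed.

Lemma carried_by_sub m (v : 'I_m.+1 -> V) f g :
  carried_by v f -> (forall w, f w = 0 -> g w = 0) -> carried_by v g.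
Proof. by move=> cf fg w /cf /fg. Qed.

Lemma carried_by_sum m (v : 'I_m.+1 -> V) f w : injective v -> carried_by v f ->
  \sum_(i | v i == w) f (v i) = f w.
Proof.
move=> vI cf; have [[i <-]|nw] := pselect (exists i, v i = w).
  by rewrite (eq_bigl (pred1 i)) ?big_pred1_eq// => j /=; rewrite (inj_eq vI).
have vw i : v i != w by apply/eqP => vi; apply: nw; exists i.
by rewrite big_pred0 ?cf// => i; apply/negbTE.
Qed.

(** A double count over the pairs with [v i = u j]; it transfers sums between two charts that both
    contain the support. *)
Lemma carried_by_total m n (v : 'I_m.+1 -> V) (u : 'I_n.+1 -> V) f :
  injective v -> injective u -> carried_by v f -> carried_by u f ->
  \sum_i f (v i) = \sum_j f (u j).
Proof.
move=> vI uI cv cu.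
rewrite (eq_bigr (fun i => \sum_(j | u j == v i) f (u j))); last first.
  by move=> i _; rewrite carried_by_sum.
rewrite (exchange_big_dep xpredT)//=; apply: eq_bigr => j _.
rewrite (eq_bigl (fun i => v i == u j)); last by move=> i; rewrite eq_sym.
rewrite -[RHS](carried_by_sum _ vI cv).
by apply: eq_bigr => i /eqP ->.
Qed.

End CarriedBy.

(* [lam x] is the family of barycentric coordinates of [x]; a chart at [x] is a
   closed simplex containing [x], with its vertices [v]. *)
Definition barycentric_chart {R : realType} (X : metricType R) (V : eqType)
    (lam : X -> V -> R) (M : R) (x : X) m (v : 'I_m.+1 -> V) : Prop :=
  [/\ injective v, carried_by v (lam x), \sum_i lam x (v i) = 1,
      forall b : 'I_m.+1 -> R, (forall i, 0 <= b i) -> \sum_i b i = 1 ->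
        exists2 y, carried_by v (lam y) & forall i, lam y (v i) = b i
    & forall y z e, carried_by v (lam y) -> carried_by v (lam z) ->
        (forall w, `|lam y w - lam z w| <= e) -> mdist y z <= M * e].

(** * Cells: centers, inner and outer balls, connectedness, nesting *)

Section Cells.
Context {R : realType} (X : metricType R) (V : eqType) (lam : X -> V -> R).
Context (N : nat) (M : R).
Hypothesis M0 : 0 < M.
Hypothesis lam_ge0 : forall x w, 0 <= lam x w.
Hypothesis lam_lip : forall x y w, `|lam x w - lam y w| <= M * mdist x y.
Hypothesis lam_chart : forall x, exists m (v : 'I_m.+1 -> V),
  (m <= N)%N /\ barycentric_chart lam M x v.

Lemma lam_inj : injective lam.
Proof.
move=> x y xy; have [m [v [_ [_ cx _ _ Hd]]]] := lam_chart x.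
apply: mdist_positivity; apply/eqP; rewrite eq_le mdist_ge0 andbT.
rewrite -(mulr0 M) Hd// -?xy// => w.
by rewrite subrr normr0.
Qed.

Lemma max_coordinate_ex : forall x, exists v, forall w, lam x w <= lam x v.
Proof.
move=> x; have [m [v [_ [_ cx _ _ _]]]] := lam_chart x.
exists (v [arg max_(i > ord0) lam x (v i)]%O) => w.
case: arg_maxP => // i _ Hi.
have [[j <-]|nw] := pselect (exists j, v j = w); first exact: Hi.
by rewrite cx// => j; apply/eqP => vj; apply: nw; exists j.
Qed.

(** Ties between maximal coordinates are broken by choice. *)
Definition top : X -> V := projT1 (choice max_coordinate_ex).

Lemma top_max x w : lam x w <= lam x (top x).
Proof. exact: (projT2 (choice max_coordinate_ex)). Qed.

Local Notation N1 := (N.+1%:R : R).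

Lemma N1_gt0 : 0 < N1. Proof. by rewrite ltr0n. Qed.

Lemma lam_le1 x w : lam x w <= 1.
Proof.
have [m [v [_ [vI cx sx _ _]]]] := lam_chart x.
rewrite -(carried_by_sum w vI cx) -sx [leRHS](bigID (fun i => v i == w))/=.
by rewrite lerDl sumr_ge0.
Qed.

(** At most N + 1 coordinates are nonzero, and they sum to 1. *)
Lemma top_ge_inv_dim x : 1 <= N1 * lam x (top x).
Proof.
have [m [v [mN [vI cx sx _ _]]]] := lam_chart x.
rewrite -[leLHS]sx (le_trans (ler_sum _ (fun i _ => top_max x (v i))))//.
rewrite sumr_const card_ord -[leLHS]mulr_natl ler_wpM2r// ler_nat ltnS//.
Qed.

Local Hint Resolve top_max top_ge_inv_dim N1_gt0 : core.

Definition code k x w : nat := dyadic_code k (lam x w / lam x (top x)).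

Lemma lam_top_gt0 x : 0 < lam x (top x).
Proof. by rewrite -(pmulr_rgt0 _ N1_gt0) (lt_le_trans ltr01). Qed.

Local Hint Resolve lam_top_gt0 : core.

Lemma code_itv k x w :
  (code k x w)%:R * lam x (top x) <= 2 ^+ k * lam x w <=
  (code k x w).+1%:R * lam x (top x).
Proof. by apply: dyadic_code_itv; rewrite // lam_ge0 top_max. Qed.

Definition cell k x : set X :=
  [set y | top y = top x /\ forall w, code k y w = code k x w].

(** As the code is below 2^k, the strict upper bounds make [top x] the unique maximal coordinate of
    [y], so the choice made in [top] cannot differ. *)
Lemma cell_intro k x y :
  (forall w, w != top x ->
    (code k x w)%:R * lam y (top x) <= 2 ^+ k * lam y w /\
    2 ^+ k * lam y w < (code k x w).+1%:R * lam y (top x)) ->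
  cell k x y.
Proof.
move=> H; have txy : top y = top x.
  apply/eqP/negPn/negP => /H[_].
  apply/negP; rewrite -leNgt -natrX.
  by rewrite ler_pM// ?ler_nat// ?dyadic_code_lt.
split=> // w; have [->|wt] := eqVneq w (top x).
  by rewrite /code -{1}txy !divff// gt_eqF.
have := H w wt; rewrite -txy => -[H1 H2].
by apply: dyadic_code_eq => //; exact: dyadic_code_lt.
Qed.

(* The cell of [x] is cut out of every closed simplex by the inequalities
   code(w) * lam(top) <= 2^k lam(w) < (code(w) + 1) * lam(top), and these
   unnormalised coordinates satisfy all of them with a margin. *)
Definition weight k x w : R :=
  if w == top x then 1
  else if code k x w == 0%N then 0 else ((code k x w)%:R + 2^-1) / 2 ^+ k.

Lemma weight_ge0 k x w : 0 <= weight k x w.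
Proof.
by rewrite /weight; do 2![case: ifP => // _]; rewrite divr_ge0// ?exprn_ge0// addr_ge0.
Qed.

Lemma weight_le1 k x w : weight k x w <= 1.
Proof.
rewrite /weight; do 2![case: ifP => // _]; rewrite ler_pdivrMr ?exprn_gt0// mul1r.
have : (code k x w).+1%:R <= 2 ^+ k :> R by rewrite -natrX ler_nat dyadic_code_lt.
rewrite -natr1; lra.
Qed.

Local Hint Resolve weight_ge0 weight_le1 : core.

(** Using 0 instead of the midpoint at code 0 keeps the center inside every closed simplex that
    contains [x]. *)
Lemma weight_supp k x w : lam x w = 0 -> weight k x w = 0.
Proof.
move=> xw; rewrite /weight; case: eqP => [wt|_].
  by have := lam_top_gt0 x; rewrite -wt xw ltxx.
case: eqP => // /eqP; rewrite -lt0n => c0.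
have /andP[] := code_itv k x w; rewrite xw mulr0 => + _.
by rewrite leNgt mulr_gt0// ltr0n.
Qed.

Lemma weight_dist k x w : `|lam x w / lam x (top x) - weight k x w| <= (2 ^+ k)^-1.
Proof.
have p0 : 0 < 2 ^+ k :> R by rewrite exprn_gt0.
have t0 := lam_top_gt0 x.
rewrite /weight; case: eqP => [->|_].
  by rewrite divff ?gt_eqF// subrr normr0 invr_ge0 ltW.
have /andP[] := code_itv k x w.
set y := lam x w / lam x (top x); set c := code k x w.
have -> : lam x w = y * lam x (top x) by rewrite /y divfK// gt_eqF.
rewrite mulrA !ler_pM2r// => c1 c2.
rewrite -[leRHS]div1r ler_pdivlMr// -[X in _ * X]gtr0_norm// -normrM mulrBl [y * _]mulrC.
move: c2; rewrite -[c.+1%:R]natr1 ler_norml; case: eqP => [c00 c2|_ c2].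
  by rewrite mul0r; move: c1 c2; rewrite c00 mulr0n => c1 c2; apply/andP; split; lra.
by rewrite divfK ?gt_eqF//; apply/andP; split; lra.
Qed.

Lemma weight_cell k x y : cell k x y -> weight k y =1 weight k x.
Proof. by move=> [txy cxy] w; rewrite /weight txy cxy. Qed.

(** The normaliser [s] is the total of the weights: at least the weight 1 of the top vertex, at most
    the number of vertices of a chart. *)
Definition is_center k x c : Prop :=
  exists2 s, 1 <= s <= N1 & forall w, lam c w = weight k x w / s.

Lemma center_ex k x : exists c, is_center k x c.
Proof.
have [m [v [mN [vI cx sx Hb Hd]]]] := lam_chart x.
pose s := \sum_i weight k x (v i).
have cw : carried_by v (weight k x) by apply: carried_by_sub cx (@weight_supp k x).
have s1 : 1 <= s.
  have -> : 1 = weight k x (top x) by rewrite /weight eqxx.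
  rewrite -(carried_by_sum (top x) vI cw) /s [leRHS](bigID (fun i => v i == top x))/=.
  by rewrite lerDl sumr_ge0.
have sN : s <= N1.
  rewrite (le_trans (ler_sum _ (fun i _ => weight_le1 k x (v i))))//.
  by rewrite sumr_const card_ord ler_nat ltnS.
have s0 : 0 < s by rewrite (lt_le_trans ltr01).
have [||c cc Hc] := Hb (fun i => weight k x (v i) / s).
- by move=> i; rewrite divr_ge0// ltW.
- by rewrite -mulr_suml divff// gt_eqF.
have cws : carried_by v (fun w => weight k x w / s) by move=> w /cw ->; rewrite mul0r.
by exists c, s; rewrite ?s1// => w; rewrite (carried_by_ext cc cws Hc).
Qed.

(** The weights depend only on the cell and vanish wherever the coordinates of [y] do, so the center
    lies in each closed simplex that meets the cell. *)
Lemma center_chart k x c y m (v : 'I_m.+1 -> V) :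
  is_center k x c -> cell k x y -> barycentric_chart lam M y v ->
  carried_by v (lam c) /\ \sum_i lam c (v i) = 1.
Proof.
move=> [s _ Hc] xy [vI cy _ _ _].
have cc : carried_by v (lam c).
  apply: (carried_by_sub cy) => w yw.
  by rewrite Hc -(weight_cell xy) weight_supp// mul0r.
split=> //; have [n [u [_ [uI cu <- _ _]]]] := lam_chart c.
exact: carried_by_total.
Qed.

(** Divided by its top coordinate, [y] has coordinates within 2^-k of the weights; the totals then
    differ by at most N1 / 2^k, and normalisation adds the two errors. *)
Lemma center_dist k x c y : is_center k x c -> cell k x y ->
  mdist y c <= M * ((N1 + 1) / 2 ^+ k).
Proof.
move=> xc xy; have [m [v [mN yv]]] := lam_chart y.
have [cc sc] := center_chart xc xy yv.
case: xc => s /andP[s1 _] Hc; case: yv => vI cy sy _ Hd.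
have s0 : 0 < s by rewrite (lt_le_trans ltr01).
have lamc w : lam c w = weight k y w / s by rewrite Hc (weight_cell xy).
have sE : s = \sum_i weight k y (v i).
  rewrite -[LHS]mul1r -sc mulr_suml; apply: eq_bigr => i _.
  by rewrite lamc divfK// gt_eqF.
apply: Hd => // w; rewrite lamc.
have t0 := lam_top_gt0 y; set t := lam y (top y) in t0 *.
have p0 : 0 < 2 ^+ k :> R by rewrite exprn_gt0.
have tV : t^-1 = \sum_i lam y (v i) / t by rewrite -mulr_suml sy mul1r.
have dt : `|t^-1 - s| <= N1 / 2 ^+ k.
  rewrite tV sE -sumrB (le_trans (ler_norm_sum _ _ _))//.
  rewrite (le_trans (ler_sum _ (fun i _ => weight_dist k y (v i))))//.
  rewrite sumr_const card_ord -[leLHS]mulr_natl.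
  by rewrite ler_wpM2r// ?invr_ge0 ?(ltW p0)// ler_nat.
(* The first term is the error of one weight, the second the error of the normaliser, whose exact
   value on the side of [y] is 1 / t. *)
have -> : lam y w - weight k y w / s =
   t * (lam y w / t - weight k y w) + t * (weight k y w / s) * (s - t^-1).
  by field; rewrite !gt_eqF.
rewrite (le_trans (ler_normD _ _))// mulrDl addrC lerD//.
  rewrite normrM -[leRHS]mul1r distrC ler_pM//.
  have ws : 0 <= weight k y w / s <= 1.
    rewrite divr_ge0 ?(ltW s0)// ler_pdivrMr// mul1r.
    by rewrite (le_trans (weight_le1 _ _ _)).
  move: ws => /andP[ws0 ws1].
  by rewrite ger0_norm ?(mulr_ge0 (ltW t0) ws0)// mulr_ile1// ?(ltW t0) ?lam_le1.
rewrite normrM ler_pM//; last exact: weight_dist.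
by rewrite ger0_norm ?(ltW t0) ?lam_le1.
Qed.

(** A midpoint is half a unit away from both ends of its interval, the unit being the top coordinate
    1 / s. At code 0 the coordinate is 0, which leaves a full unit above it. *)
Lemma center_margin k x c w : is_center k x c -> w != top x ->
  [/\ 1 <= N1 * lam c (top x),
      code k x w = 0%N \/
        (code k x w)%:R * lam c (top x) + lam c (top x) / 2 <= 2 ^+ k * lam c w
    & 2 ^+ k * lam c w + lam c (top x) / 2 <= ((code k x w)%:R + 1) * lam c (top x)].
Proof.
move=> [s /andP[s1 sN] Hc] wt.
have p0 : 0 < 2 ^+ k :> R by rewrite exprn_gt0.
have s0 : 0 < s by rewrite (lt_le_trans ltr01).
have lc : lam c (top x) = s^-1 by rewrite Hc /weight eqxx div1r.
have lw : 2 ^+ k * lam c w =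
    (if code k x w == 0%N then 0 else (code k x w)%:R + 2^-1) * s^-1.
  rewrite Hc /weight (negPf wt); case: eqP => _; first by rewrite !mul0r mulr0.
  by field; rewrite !gt_eqF.
have sV : 0 < s^-1 by rewrite invr_gt0.
rewrite lc lw; split.
- by rewrite ler_pdivlMr// mul1r.
- by case: eqP => [->|_]; [left|right; lra].
- case: eqP => [->|_]; rewrite ?mulr0n; lra.
Qed.

(** The coefficients in the inequalities are at most 2^k, so each side moves by at most 1 / (8 N1),
    an eighth of the top coordinate of [c]; the margin is half of it. The argument treats each [w]
    separately, including the vertices outside the simplex of [c]. *)
Lemma ball_center k x c y : is_center k x c ->
  (forall w, `|lam y w - lam c w| <= (8 * N1)^-1 / 2 ^+ k) -> cell k x y.
Proof.
move=> xc yc; apply: cell_intro => w wt.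
have p0 : 0 < 2 ^+ k :> R by rewrite exprn_gt0.
have [c1 c2 c3] := center_margin xc wt.
set l := lam c (top x) in c1 c2 c3; set j := code k x w in c2 c3 *.
set e := (8 * N1)^-1 / 2 ^+ k in yc.
have j1 : j%:R + 1 <= 2 ^+ k :> R by rewrite natr1 -natrX ler_nat dyadic_code_lt.
have el : 8 * (2 ^+ k * e) <= l.
  have -> : 8 * (2 ^+ k * e) = 1 / N1 by rewrite /e; field; rewrite !gt_eqF.
  by rewrite ler_pdivrMr// mulrC.
have l0 : 0 < l by rewrite -(pmulr_rgt0 _ N1_gt0) (lt_le_trans ltr01).
have perturb (a : R) w' : 0 <= a <= 2 ^+ k ->
    - (2 ^+ k * e) <= a * (lam y w' - lam c w') <= 2 ^+ k * e.
  move=> /andP[a0 aq]; rewrite -ler_norml normrM ler_pM//.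
  by rewrite ger0_norm.
have pj : 0 <= (j%:R : R) <= 2 ^+ k by rewrite ler0n; lra.
have pj1 : 0 <= (j%:R + 1 : R) <= 2 ^+ k by rewrite j1 andbT addr_ge0.
have pq : 0 <= (2 ^+ k : R) <= 2 ^+ k by rewrite (ltW p0) lexx.
have := perturb _ (top x) pj; have := perturb _ (top x) pj1; have := perturb _ w pq.
rewrite -/l -[j.+1%:R]natr1 !mulrBr => /andP[h1 h2] /andP[h3 h4] /andP[h5 h6].
split; last by lra.
have : j = 0%N \/ j%:R * l + l / 2 <= 2 ^+ k * lam c w by [].
case => [->|c2']; last by lra.
by rewrite mulr0n mul0r mulr_ge0// exprn_ge0.
Qed.

Lemma center_cell k x c : is_center k x c -> cell k x c.
Proof.
move=> xc; apply: (ball_center xc) => w.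
by rewrite subrr normr0 divr_ge0 ?exprn_ge0// invr_ge0 mulr_ge0.
Qed.

(* min (max t 0) 1, written so that [clamp_lip] is the triangle inequality *)
Definition clamp (t : R) : R := (1 + `|t| - `|t - 1|) / 2.

Lemma clamp_itv t : 0 <= clamp t <= 1.
Proof.
rewrite /clamp; have := ler_normB t 1; have := ler_normD (t - 1) 1.
by rewrite subrK normr1; lra.
Qed.

Lemma clamp_lip s t : `|clamp s - clamp t| <= `|s - t|.
Proof.
have h1 := ler_dist_dist s t; have h2 := ler_dist_dist (s - 1) (t - 1).
have st : s - 1 - (t - 1) = s - t by ring.
rewrite st in h2; move: h1 h2; rewrite /clamp ler_norml => /andP[h1 h2].
rewrite ler_norml => /andP[h3 h4].
by rewrite ler_norml; apply/andP; split; lra.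
Qed.

(** The segment is drawn in a chart of [y], which also contains [c]; with [clamp] it becomes a
    continuous image of the whole real line. *)
Lemma cell_segment k x c y : is_center k x c -> cell k x y ->
  exists A, [/\ connected A, A `<=` cell k x, A y & A c].
Proof.
move=> xc xy; have [m [v [mN yv]]] := lam_chart y.
have [cc sc] := center_chart xc xy yv; have [vI cy sy Hb Hd] := yv.
have zP t : exists z, forall w,
    lam z w = (1 - clamp t) * lam y w + clamp t * lam c w.
  have /andP[t0 t1] := clamp_itv t.
  have [||z cz Hz] := Hb (fun i => (1 - clamp t) * lam y (v i) + clamp t * lam c (v i)).
  - by move=> i; rewrite addr_ge0// mulr_ge0// subr_ge0.
  - by rewrite big_split/= -!mulr_sumr sy sc !mulr1 subrK.
  pose f w := (1 - clamp t) * lam y w + clamp t * lam c w.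
  have cf : carried_by v f by move=> w wv; rewrite /f cy// cc// !mulr0 addr0.
  by exists z => w; rewrite (carried_by_ext cz cf Hz).
have [g gP] := choice zP.
have cg t : carried_by v (lam (g t)).
  by move=> w wv; rewrite gP cy// cc// !mulr0 addr0.
have glip s t : mdist (g s) (g t) <= M * `|s - t|.
  apply: Hd => // w; rewrite !gP.
  have -> : (1 - clamp s) * lam y w + clamp s * lam c w -
     ((1 - clamp t) * lam y w + clamp t * lam c w) =
     (clamp s - clamp t) * (lam c w - lam y w) by ring.
  rewrite normrM -[leRHS]mulr1 ler_pM ?clamp_lip//.
  have := lam_le1 c w; have := lam_le1 y w; have := lam_ge0 c w; have := lam_ge0 y w.
  by rewrite ler_norml => *; apply/andP; split; lra.
have gc : continuous g.
  move=> t; apply/metricType_numDomainType.cvgrPdist_lt => e e0.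
  near=> s; rewrite (le_lt_trans (glip _ _))// mulrC -ltr_pdivlMr//.
  by near: s; apply: cvgr_dist_lt => //; rewrite divr_gt0.
have clamp0 : clamp 0 = 0 by rewrite /clamp sub0r normr0 normrN normr1; lra.
have clamp1 : clamp 1 = 1 by rewrite /clamp subrr normr0 normr1; lra.
exists (range g); split.
- apply: connected_continuous_connected; last exact: continuous_subspaceT.
  by apply/connected_intervalP => ? ? _ _ ? _.
- move=> _ [t _ <-].
  (* At parameter 0 the point is [y], where upper bounds may be equalities; at positive parameters
     the margin at [c] makes them strict. *)
  have /andP[] := clamp_itv t; rewrite le_eqVlt => /predU1P[t0 _|t0 t1].
    suff -> : g t = y by [].
    by apply: lam_inj; apply/funext => w; rewrite gP -t0 mul0r addr0 subr0 mul1r.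
  apply: cell_intro => w wt; rewrite !gP.
  have [c1 c2 c3] := center_margin xc wt.
  have l0 : 0 < lam c (top x) by rewrite -(pmulr_rgt0 _ N1_gt0) (lt_le_trans ltr01).
  case: xy => txy cxy.
  have := code_itv k y w; rewrite txy cxy => /andP[y1 y2].
  move: y2 c3; rewrite -[(code _ _ _).+1%:R]natr1.
  set q := 2 ^+ k in y1 c2 *; set j := (code k x w)%:R in y1 c2 * => y2 c3.
  have c2' : j * lam c (top x) <= q * lam c w.
    case: c2 => [j0|]; last by lra.
    by rewrite /j j0 mulr0n mul0r mulr_ge0// exprn_ge0.
  have c3' : 0 < (j + 1) * lam c (top x) - q * lam c w by lra.
  have s0 : 0 <= 1 - clamp t by rewrite subr_ge0.
  have h1 : 0 <= (1 - clamp t) * (q * lam y w - j * lam y (top x)).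
    by rewrite mulr_ge0// subr_ge0.
  have h2 : 0 <= (1 - clamp t) * ((j + 1) * lam y (top x) - q * lam y w).
    by rewrite mulr_ge0// subr_ge0.
  have h3 : 0 <= clamp t * (q * lam c w - j * lam c (top x)).
    by rewrite mulr_ge0 ?(ltW t0)// subr_ge0.
  have h4 := mulr_gt0 t0 c3'.
  by split; lra.
- exists 0 => //; apply: lam_inj; apply/funext => w.
  by rewrite gP clamp0 mul0r addr0 subr0 mul1r.
- exists 1 => //; apply: lam_inj; apply/funext => w.
  by rewrite gP clamp1 subrr mul0r add0r mul1r.
Unshelve. all: by end_near. Qed.

Lemma cell_connected k x : connected (cell k x).
Proof.
have [c xc] := center_ex k x.
have segP (y : X) : exists A, cell k x y -> [/\ connected A, A `<=` cell k x, A y & A c].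
  have [xy|nxy] := pselect (cell k x y); last by exists set0.
  by have [A ?] := cell_segment xc xy; exists A.
have [A AP] := choice segP.
have -> : cell k x = \bigcup_(y in cell k x) A y.
  apply/seteqP; split=> [y xy|y [z xz Azy]]; first by exists y => //; case: (AP y xy).
  by have [_ + _ _] := AP z xz; exact.
apply: bigcup_connected; last by move=> y /AP[].
by exists c => y /AP[].
Qed.

Lemma cell_eq k x y : cell k x y -> cell k y = cell k x.
Proof.
by move=> [txy cxy]; apply/seteqP; split=> z [tz cz]; split=> [|w]; rewrite ?tz ?cz.
Qed.

Lemma cell_nested k l x : (k <= l)%N -> cell l x `<=` cell k x.
Proof.
move=> /subnK <-; elim: (l - k)%N => [//|n IHn].
apply: subset_trans IHn => y [txy cxy]; split=> // w.
rewrite /code !(@dyadic_code_half _ (n + k)) ?divr_ge0//.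
by have := cxy w; rewrite addSn /code => ->.
Qed.

(** The first term serves the inner ball, through the Lipschitz constant of the coordinates; the
    second is the outer radius from [center_dist]. *)
Definition cell_scale : R := 8 * N1 * M + M * (N1 + 1) + 1.

Lemma cell_scaleP :
  [/\ 0 < cell_scale, 8 * N1 * M <= cell_scale & M * (N1 + 1) < cell_scale].
Proof.
have : 0 < 8 * N1 * M by rewrite !mulr_gt0.
have : 0 < M * (N1 + 1) by rewrite mulr_gt0// addr_gt0.
by rewrite /cell_scale; move: (8 * N1 * M) (M * (N1 + 1)) => a b a0 b0; split; lra.
Qed.

Lemma cell_ball k x : exists c,
  [/\ cell k x c, ball c (cell_scale^-1 * 2^-1 ^+ k) `<=` cell k x
    & cell k x `<=` ball c (cell_scale * 2^-1 ^+ k)].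
Proof.
have p0 : 0 < (2 ^+ k)^-1 :> R by rewrite invr_gt0 exprn_gt0.
have [s0 s1 s2] := cell_scaleP.
have [c xc] := center_ex k x.
exists c; rewrite exprVn; split; first exact: center_cell.
- move=> y; rewrite ballEmdist /= => cy; apply: (ball_center xc) => w.
  rewrite distrC (le_trans (lam_lip _ _ _))//.
  rewrite -ler_pdivlMl// (le_trans (ltW cy))// mulrA ler_pM2r//.
  by rewrite -invfM lef_pV2 ?posrE ?mulr_gt0// mulrC.
- move=> y xy; rewrite ballEmdist /=.
  by rewrite metric_sym (le_lt_trans (center_dist xc xy))// mulrA ltr_pM2r.
Qed.

Lemma cube_decomposable_of_coordinates : cube_decomposable X.
Proof.
(* The index is the cell as a set and not a point of it, since [trivIset] demands that overlapping
   members have equal indices. *)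
pose I k := {A : set X | exists x, A = cell k x}.
exists I, (fun k a => proj1_sig a); split; last first.
  by move=> k [A [x Ax]]; rewrite /= Ax; exact: cell_connected.
exists cell_scale, 2^-1; split.
- by have [] := cell_scaleP.
- by apply/andP; split; lra.
- move=> k; split.
    apply/seteqP; split=> // x _.
    by exists (exist _ (cell k x) (ex_intro _ x erefl)).
  move=> [A Ax] [B Bx] _ _ /= [z [Az Bz]]; apply: eq_exist => /=.
  by case: Ax Az => x -> /cell_eq <-; case: Bx Bz => y -> /cell_eq <-.
- move=> k l [A [x Ax]] [B [y By]] kl; rewrite /= Ax By.
  have [xy|nxy] := pselect (cell k x = cell k y).
    by left; rewrite -xy; exact: cell_nested.
  right; apply/seteqP; split=> // z [/(cell_nested kl)/cell_eq zx /cell_eq zy].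
  by apply: nxy; rewrite -zx zy.
- by move=> k [A [x Ax]]; rewrite /= Ax; exact: cell_ball.
Qed.

End Cells.

(** * Simplices and their barycentric coordinates *)

Section Affine.
Context {R : realType} {D : nat}.
Local Notation E := 'rV[R]_D.

Definition convex_weights m (a : 'I_m.+1 -> R) : Prop :=
  (forall i, 0 <= a i) /\ \sum_i a i = 1.

Definition closed_simplex m (v : 'I_m.+1 -> E) : set E :=
  [set x | exists2 a, convex_weights a & x = \sum_i a i *: v i].

(** Affine independence in a form symmetric in the vertices, without the base point [v ord0]. *)
Definition no_affine_relation m (v : 'I_m.+1 -> E) : Prop :=
  forall c : 'I_m.+1 -> R,
    \sum_i c i = 0 -> \sum_i c i *: v i = 0 -> forall i, c i = 0.

(** Barycentric coordinates indexed by points of the ambient space instead of positions in [v],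
    hence comparable between different simplices. *)
Definition vertex_weight m (v : 'I_m.+1 -> E) (a : 'I_m.+1 -> R) (w : E) : R :=
  \sum_(i | v i == w) a i.

Lemma affinely_independentP m (v : 'I_m.+1 -> E) :
  affinely_independent v <-> no_affine_relation v.
Proof.
have relE (c : 'I_m.+1 -> R) : \sum_i c i = 0 -> \sum_i c i *: v i =
    \sum_(i < m) c (lift ord0 i) *:
      [tuple v (lift ord0 i) - v ord0 | i < m]`_i.
  rewrite big_ord_recl => /eqP; rewrite addr_eq0 => /eqP c0.
  rewrite big_ord_recl c0 scaleNr scaler_suml addrC -sumrB.
  by apply: eq_bigr => i _; rewrite nth_mktuple scalerBr.
rewrite /affinely_independent; split=> [/freeP fv c c0 cv|nv].
  have cl i : c (lift ord0 i) = 0.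
    by apply: (fv (fun i => c (lift ord0 i))); rewrite -relE.
  move=> i; have [j ->|->] := unliftP ord0 i; first exact: cl.
  by move: c0; rewrite big_ord_recl big1 ?addr0.
apply/freeP => k k0 i.
pose c j := if unlift ord0 j is Some i then k i else - \sum_i k i.
have cl j : c (lift ord0 j) = k j by rewrite /c liftK.
have c0 : \sum_j c j = 0.
  have -> : \sum_j c j = c ord0 + \sum_i k i.
    by rewrite big_ord_recl; congr (_ + _); apply: eq_bigr => j _; rewrite cl.
  by rewrite /c unlift_none addNr.
rewrite -cl; apply: nv => //; rewrite relE//.
by rewrite -[RHS]k0; apply: eq_bigr => j _; rewrite cl.
Qed.

Lemma affinely_independent_dim m (v : 'I_m.+1 -> E) :
  affinely_independent v -> (m <= D)%N.
Proof.
rewrite /affinely_independent /free => /eqP; rewrite size_tuple => <-.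
by rewrite (leq_trans (dimvS (subvf _)))// dimvf /dim/= mul1n.
Qed.

Section Independent.
Context {m : nat} (v : 'I_m.+1 -> E).
Hypothesis vA : no_affine_relation v.

Lemma affine_coord_inj (a b : 'I_m.+1 -> R) : \sum_i a i = \sum_i b i ->
  \sum_i a i *: v i = \sum_i b i *: v i -> a = b.
Proof.
move=> ab vab; apply/funext => i; apply/eqP; rewrite -subr_eq0; apply/eqP.
apply: (vA (c := fun i => a i - b i)); first by rewrite sumrB ab subrr.
by under eq_bigr do rewrite scalerBl; rewrite sumrB vab subrr.
Qed.

Lemma no_affine_relation_inj : injective v.
Proof.
move=> i j vij; apply/eqP/negPn/negP => ij.
have /(congr1 (fun f => f i)) : (fun k => (k == i)%:R : R) = (fun k => (k == j)%:R).
  have sumd k : \sum_l (l == k)%:R = 1 :> R.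
    by rewrite (bigD1 k)//= eqxx big1 ?addr0// => l /negbTE ->.
  have sumdv k : \sum_l (l == k)%:R *: v l = v k.
    by rewrite (bigD1 k)//= eqxx scale1r big1 ?addr0// => l /negbTE ->; rewrite scale0r.
  by apply: affine_coord_inj; rewrite ?sumd ?sumdv.
by move/eqP; rewrite eqxx (negPf ij) oner_eq0.
Qed.

Lemma no_affine_relation_comp l (f : 'I_l.+1 -> 'I_m.+1) :
  injective f -> no_affine_relation (v \o f).
Proof.
move=> fI c c0 cv i.
pose c' j := \sum_(k | f k == j) c k.
have <- : c' (f i) = c i.
  by rewrite /c' (eq_bigl (pred1 i)) ?big_pred1_eq// => k /=; rewrite (inj_eq fI).
apply: vA.
  by rewrite -[RHS]c0 (partition_big f xpredT).
rewrite -[RHS]cv (partition_big f xpredT)//=; apply: eq_bigr => j _.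
by rewrite scaler_suml; apply: eq_bigr => k /eqP ->.
Qed.

(** Pushing the weights [a] forward along [s] gives coordinates of the same point with respect to
    [v]; by independence these are [b]. *)
Lemma vertex_weight_push l (u : 'I_l.+1 -> E) (s : 'I_l.+1 -> 'I_m.+1) a b :
  (forall i, u i = v (s i)) -> \sum_i a i = \sum_i b i ->
  \sum_i a i *: u i = \sum_i b i *: v i -> vertex_weight u a = vertex_weight v b.
Proof.
move=> us ab uv.
have <- : (fun j => \sum_(k | s k == j) a k) = b.
  apply: affine_coord_inj; first by rewrite -ab [RHS](partition_big s xpredT).
  rewrite -uv [RHS](partition_big s xpredT)//=; apply: eq_bigr => j _.
  by rewrite scaler_suml; apply: eq_bigr => k /eqP <-; rewrite us.
apply/funext => w; rewrite /vertex_weight.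
rewrite (partition_big s (fun j => v j == w))/=; last by move=> i; rewrite us.
apply: eq_bigr => j vj; apply: eq_bigl => i.
by rewrite us; case: (s i =P j) => [->|]; rewrite ?vj ?andbF.
Qed.

End Independent.

Lemma closed_simplex_vertex m (v : 'I_m.+1 -> E) i : closed_simplex v (v i).
Proof.
exists (fun k => (k == i)%:R); last first.
  by rewrite (bigD1 i)//= eqxx scale1r big1 ?addr0// => l /negbTE ->; rewrite scale0r.
split; first by move=> k; rewrite ler0n.
by rewrite (bigD1 i)//= eqxx big1 ?addr0// => l /negbTE ->.
Qed.

(* The vertices are the extreme points of a closed simplex: if v_i = sum_j A_ij u_j
   and u_j = sum_k B_jk v_k then AB = 1, so A_ij <> 0 forces u_j = v_i. *)
Lemma closed_simplex_vertices m l (v : 'I_m.+1 -> E) (u : 'I_l.+1 -> E) :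
  no_affine_relation v -> closed_simplex v = closed_simplex u ->
  exists s : 'I_m.+1 -> 'I_l.+1, forall i, v i = u (s i).
Proof.
move=> vA vu.
have /choice[A AP] i : exists a, convex_weights a /\ v i = \sum_j a j *: u j.
  have : closed_simplex u (v i) by rewrite -vu; exact: closed_simplex_vertex.
  by case=> a ? ?; exists a.
have /choice[B BP] j : exists b, convex_weights b /\ u j = \sum_k b k *: v k.
  have : closed_simplex v (u j) by rewrite vu; exact: closed_simplex_vertex.
  by case=> a ? ?; exists a.
suff /choice[s sP] : forall i, exists j, v i = u j by exists s.
move=> i; have [[A0 A1] Av] := AP i.
have [j Aj] : exists j, A i j != 0.
  apply: contrapT => /forallNP A00.
  have : \sum_j A i j = 0 by apply: big1 => j _; apply/eqP/negPn/negP/A00.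
  by rewrite A1 => /eqP; rewrite oner_eq0.
exists j; have [[B0 B1] Bu] := BP j.
have AB : (fun k => \sum_j A i j * B j k) = (fun k => (k == i)%:R).
  apply: (affine_coord_inj vA).
    rewrite exchange_big/= (eq_bigr (A i)).
      by rewrite A1 (bigD1 i)//= eqxx big1 ?addr0// => l' /negbTE ->.
    by move=> j' _; rewrite -mulr_sumr (BP j').1.2 mulr1.
  rewrite [RHS](bigD1 i)//= eqxx scale1r [X in _ = _ + X]big1 ?addr0; last first.
    by move=> k /negbTE ->; rewrite scale0r.
  rewrite [RHS]Av; under eq_bigr do rewrite scaler_suml.
  rewrite exchange_big/=; apply: eq_bigr => j' _.
  by rewrite (BP j').2 scaler_sumr; apply: eq_bigr => k _; rewrite scalerA.
have Bk k : k != i -> B j k = 0.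
  move=> ki; have := congr1 (fun f => f k) AB; rewrite /= (negPf ki) => /eqP.
  rewrite psumr_eq0; last by move=> j' _; apply: mulr_ge0; [exact: A0|exact: (BP j').1.1].
  by move=> /allP/(_ j (mem_index_enum _)); rewrite mulf_eq0 (negPf Aj) => /eqP.
have Bi : B j i = 1.
  by rewrite -B1 (bigD1 i)//= big1 ?addr0// => k /Bk.
by rewrite Bu (bigD1 i)//= Bi scale1r big1 ?addr0// => k /Bk ->; rewrite scale0r.
Qed.

Lemma vertex_weight_unique m l (v : 'I_m.+1 -> E) (u : 'I_l.+1 -> E) a b :
  no_affine_relation v -> no_affine_relation u ->
  closed_simplex v = closed_simplex u ->
  \sum_i a i = \sum_i b i -> \sum_i a i *: v i = \sum_i b i *: u i ->
  vertex_weight v a = vertex_weight u b.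
Proof.
move=> vA uA /(closed_simplex_vertices vA)[s sP].
exact: (vertex_weight_push uA sP).
Qed.

End Affine.

(** * Closures of open simplices *)

Section Closure.
Context {R : realType} {D : nat}.
Local Notation E := 'rV[R]_D.

(** It is the continuous image of the compact set of convex weights. *)
Lemma closed_simplex_closed m (v : 'I_m.+1 -> E) : closed (closed_simplex v).
Proof.
pose W : set 'rV[R]_m.+1 := [set a | (forall i, `[0, 1]%classic (a ord0 i))]
  `&` (fun a => \sum_i a ord0 i) @^-1` [set 1].
have -> : closed_simplex v = (fun a : 'rV[R]_m.+1 => \sum_i a ord0 i *: v i) @` W.
  apply/seteqP; split=> [_ [a [a0 a1] ->]|_ [a [a01 a1] <-]].
    exists (\row_i a i); last by apply: eq_bigr => i _; rewrite mxE.
    split=> /=; last by rewrite -[RHS]a1; apply: eq_bigr => i _; rewrite mxE.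
    move=> i; rewrite mxE in_itv/= a0/= -a1 (bigD1 i)//= lerDl.
    by apply: sumr_ge0 => j _.
  exists (fun i => a ord0 i) => //; split=> // i.
  by have := a01 i; rewrite /= in_itv/= => /andP[].
have coordC i : continuous (fun a : 'rV[R]_m.+1 => a ord0 i) by exact: coord_continuous.
apply: compact_closed; first exact: norm_hausdorff.
apply: continuous_compact.
  apply: continuous_subspaceT; apply: continuous_big => [|i _].
    exact: add_continuous.
  by move=> a; apply: continuousZr_tmp; exact: coordC.
apply: compact_closedI; last first.
  apply: (iffLR (continuous_closedP _)); last exact: closed_eq.
  have addC : continuous (fun z : R * R => z.1 + z.2) by exact: add_continuous.
  apply: (@continuous_big R _ _ 0 _ addC) => i _; exact: coordC.
by apply: (@rV_compact R _ (fun=> `[0, 1]%classic)) => i; exact: segment_compact.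
Qed.

Lemma closure_open_simplex m (v : 'I_m.+1 -> E) :
  closure (open_simplex v) = closed_simplex v.
Proof.
apply/seteqP; split.
  rewrite [X in _ `<=` X](closure_id _).1; last exact: closed_simplex_closed.
  apply: closure_subset => _ [a [a0 a1 ->]].
  by exists a => //; split=> // i; exact: ltW.
move=> _ [a [a0 a1] ->] B.
pose b : R := m.+1%:R^-1.
have b0 : 0 < b by rewrite invr_gt0.
have b1 : \sum_(i < m.+1) b = 1 by rewrite sumr_const card_ord -[LHS]mulr_natl divff.
(* Moving towards the barycentre makes all weights positive at once. *)
pose g (t : R) : E := \sum_i a i *: v i + t *: \sum_i (b - a i) *: v i.
have gc : {for 0, continuous g}.
  by apply: cvgD; [exact: cvg_cst|apply: cvgZr_tmp; exact: cvg_id].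
have -> : \sum_i a i *: v i = g 0 by rewrite /g scale0r addr0.
move=> /gc /nbhs_ballP[e /= e0 eB].
pose t := Num.min (e / 2) 1.
have t0 : 0 < t by rewrite /t lt_min divr_gt0//=.
have t1 : t <= 1 by rewrite /t ge_min lexx orbT.
have te : t < e by rewrite /t gt_min ltr_pdivrMr// mulr_natr mulr2n ltrDl e0.
exists (g t); split; last by apply: eB; rewrite /ball/= sub0r normrN gtr0_norm.
exists (fun i => a i + t * (b - a i)); split.
- move=> i; have -> : a i + t * (b - a i) = (1 - t) * a i + t * b by ring.
  by rewrite ltr_wpDl// ?mulr_gt0// mulr_ge0// subr_ge0.
- by rewrite big_split/= -mulr_sumr sumrB a1 b1 subrr mulr0 addr0.
- rewrite /g scaler_sumr -big_split/=; apply: eq_bigr => i _.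
  by rewrite [RHS]scalerDl scalerA.
Qed.

End Closure.

(** * The metric of a single simplex *)

Section RegularSimplex.
Context {R : realType}.

Lemma enormE n (x : 'rV[R]_n) : enorm x ^+ 2 = \sum_i x ord0 i ^+ 2.
Proof. by rewrite sqr_sqrtr// sumr_ge0// => i _; rewrite sqr_ge0. Qed.

Lemma enorm_ge0 n (x : 'rV[R]_n) : 0 <= enorm x.
Proof. exact: sqrtr_ge0. Qed.

(* Polarisation: 2 <e_i, e_j> = |e_i|^2 + |e_j|^2 - [i <> j], and the first two
   terms do not contribute because sum_i c_i = 0. *)
Lemma enorm_regular m (e : 'I_m.+1 -> 'rV[R]_m) (c : 'I_m.+1 -> R) :
  regular_unit_simplex e -> \sum_i c i = 0 ->
  2 * enorm (\sum_i c i *: e i) ^+ 2 = \sum_i c i ^+ 2.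
Proof.
move=> eR c0.
pose s i := enorm (e i) ^+ 2.
have polar i j : 2 * (\sum_k e i ord0 k * e j ord0 k) = s i + s j - (i != j)%:R.
  have <- : enorm (e i - e j) ^+ 2 = (i != j)%:R.
    have [->|ij] := eqVneq i j; last by rewrite eR// expr1n.
    by rewrite subrr enormE big1// => k _; rewrite mxE expr0n.
  rewrite /s !enormE mulr_sumr -big_split/= -sumrB; apply: eq_bigr => k _.
  by rewrite !mxE; ring.
have -> : 2 * enorm (\sum_i c i *: e i) ^+ 2 =
    \sum_i \sum_j c i * c j * (2 * \sum_k e i ord0 k * e j ord0 k).
  rewrite enormE mulr_sumr.
  under [RHS]eq_bigr => i _ do under eq_bigr => j _ do rewrite !mulr_sumr.
  under [RHS]eq_bigr do rewrite exchange_big/=.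
  rewrite [RHS]exchange_big/=; apply: eq_bigr => k _.
  rewrite summxE expr2 mulr_suml mulr_sumr; apply: eq_bigr => i _.
  rewrite mulr_sumr mulr_sumr; apply: eq_bigr => j _.
  by rewrite !mxE; ring.
have sumc (f : 'I_m.+1 -> R) : \sum_i \sum_j c i * c j * f i = 0.
  apply: big1 => i _; rewrite -mulr_suml -mulr_sumr c0 mulr0 mul0r//.
transitivity (\sum_i \sum_j (c i * c j * s i + c j * c i * s j
    - (c i * c j - c i * c j * (i == j)%:R))).
  apply: eq_bigr => i _; apply: eq_bigr => j _; rewrite polar.
  by case: (i == j); rewrite ?mulr1n ?mulr0n; ring.
under eq_bigr do rewrite sumrB big_split/= sumrB.
rewrite sumrB big_split/= sumrB sumc exchange_big/= sumc add0r sub0r.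
rewrite [X in - (X - _)](_ : _ = 0) ?sub0r ?opprK; last first.
  by apply: big1 => i _; rewrite -mulr_sumr c0 mulr0.
apply: eq_bigr => i _; rewrite (bigD1 i)//= eqxx mulr1 big1 ?addr0 ?expr2// => j.
by rewrite eq_sym => /negbTE ->; rewrite mulr0.
Qed.

(** By [enorm_regular] the squares of the coefficients of a relation sum to 0. *)
Lemma regular_no_affine_relation m (e : 'I_m.+1 -> 'rV[R]_m) :
  regular_unit_simplex e -> no_affine_relation e.
Proof.
move=> eR c c0 ce i; have := enorm_regular eR c0.
rewrite ce enormE big1; last by move=> k _; rewrite mxE expr0n.
rewrite mulr0 => /esym/eqP; rewrite psumr_eq0; last by move=> j _; rewrite sqr_ge0.
by move=> /allP/(_ i (mem_index_enum _)); rewrite sqrf_eq0 => /eqP.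
Qed.

(* e_0 = r s (1, ..., 1) and e_(j+1) = r delta_j with r^2 = 1/2, where s is a root
   of m s^2 - 2 s - 1 *)
Lemma regular_simplex_exists m : exists e : 'I_m.+1 -> 'rV[R]_m,
  regular_unit_simplex e /\ forall D (v : 'I_m.+1 -> 'rV[R]_D),
    exists (A : 'M[R]_(m, D)) (b : 'rV[R]_D), forall i, e i *m A + b = v i.
Proof.
pose q : R := Num.sqrt m.+1%:R.
have qq : q ^+ 2 = m%:R + 1 by rewrite sqr_sqrtr ?natr1.
have q0 : 0 < q by rewrite sqrtr_gt0.
(* This is the root (1 - q) / m, rewritten so that it also covers m = 0. *)
pose s := - (1 + q)^-1.
have sm : 1 - s * m%:R = q.
  have -> : m%:R = q ^+ 2 - 1 by rewrite qq addrK.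
  by rewrite /s; field; rewrite gt_eqF// addr_gt0.
have ss : s ^+ 2 * m%:R - 2 * s = 1.
  have -> : m%:R = q ^+ 2 - 1 by rewrite qq addrK.
  by rewrite /s; field; rewrite gt_eqF// addr_gt0.
pose r : R := Num.sqrt 2^-1.
have r0 : 0 < r by rewrite sqrtr_gt0.
have rr : r ^+ 2 = 2^-1 by rewrite sqr_sqrtr.
pose e (i : 'I_m.+1) : 'rV[R]_m :=
  if unlift ord0 i is Some j then r *: delta_mx ord0 j else const_mx (r * s).
have sumD (f : 'I_m -> R) (k : 'I_m) : \sum_i (i == k)%:R * f i = f k.
  by rewrite (bigD1 k)//= eqxx mul1r big1 ?addr0// => i /negbTE ->; rewrite mul0r.
exists e; split.
  have e1 (x : 'rV[R]_m) : \sum_i x ord0 i ^+ 2 = 1 -> enorm x = 1.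
    by move=> x1; rewrite /enorm x1 sqrtr1.
  have eE (k : 'I_m) : \sum_i (r * (i == k)%:R - r * s) ^+ 2 = 1.
    transitivity (\sum_i (r ^+ 2 * s ^+ 2 + (i == k)%:R * (r ^+ 2 * (1 - 2 * s)))).
      by apply: eq_bigr => i _; case: (i == k); rewrite ?mulr1n ?mulr0n; ring.
    rewrite big_split/= sumr_const card_ord sumD -mulr_natr rr; lra.
  move=> i j; rewrite /e.
  case: (unliftP ord0 i) => [i' ->|->]; case: (unliftP ord0 j) => [j' ->|->] ij.
  - apply: e1.
    have ij' : i' != j' by move: ij; apply: contra => /eqP ->.
    transitivity (\sum_k ((k == i')%:R * r ^+ 2 + (k == j')%:R * r ^+ 2)).
      apply: eq_bigr => k _; rewrite !mxE eqxx/=.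
      have [ki|ki] := eqVneq k i'; have [kj|kj] := eqVneq k j';
        rewrite ?mulr1n ?mulr0n; try ring.
      by move: ij'; rewrite -ki kj eqxx.
    by rewrite big_split/= !sumD rr; lra.
  - by apply: e1; rewrite -[RHS](eE i'); apply: eq_bigr => k _; rewrite !mxE eqxx.
  - rewrite -[LHS](_ : enorm (r *: delta_mx ord0 j' - const_mx (r * s)) = _); last first.
      by rewrite /enorm; congr Num.sqrt; apply: eq_bigr => k _; rewrite !mxE; ring.
    by apply: e1; rewrite -[RHS](eE j'); apply: eq_bigr => k _; rewrite !mxE eqxx.
  - by rewrite eqxx in ij.
move=> D v.
(* The solution of the equation at [e ord0], which reads s sum_j v_(j+1) + (1 - s m) b = v_0 with 1
   - s m = q. *)
pose b := q^-1 *: (v ord0 - s *: \sum_j v (lift ord0 j)).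
exists (\matrix_j (r^-1 *: (v (lift ord0 j) - b))), b => i.
rewrite /e; case: (unliftP ord0 i) => [j ->|->].
  rewrite -scalemxAl -rowE rowK scalerA divff ?gt_eqF// scale1r subrK//.
have -> : const_mx (r * s) = \sum_j (r * s) *: delta_mx ord0 j :> 'rV[R]_m.
  apply/rowP => k; rewrite mxE summxE (bigD1 k)//= !mxE !eqxx mulr1 big1 ?addr0// => j jk.
  by rewrite !mxE eqxx eq_sym (negPf jk) mulr0.
rewrite mulmx_suml.
transitivity (s *: \sum_j (v (lift ord0 j) - b) + b).
  congr (_ + _); rewrite scaler_sumr; apply: eq_bigr => j _.
  by rewrite -scalemxAl -rowE rowK scalerA mulrAC divff ?gt_eqF// mul1r.
rewrite sumrB sumr_const card_ord -scaler_nat scalerBr scalerA -addrA [- _ + _]addrC.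
have -> : b - (s * m%:R) *: b = q *: b by rewrite -sm scalerBl scale1r.
by rewrite /b scalerA divff ?gt_eqF// scale1r addrC subrK.
Qed.

End RegularSimplex.

(** * The distance of a simplex compared with barycentric coordinates *)

Section SimplexDist.
Context {R : realType} {D : nat}.
Local Notation E := 'rV[R]_D.

Lemma affine_combination m n (e : 'I_m.+1 -> 'rV[R]_n) (A : 'M[R]_(n, D)) (b : E)
    (a : 'I_m.+1 -> R) : \sum_i a i = 1 ->
  (\sum_i a i *: e i) *m A + b = \sum_i a i *: (e i *m A + b).
Proof.
move=> a1; rewrite mulmx_suml -[b in LHS]scale1r -a1 scaler_suml -big_split/=.
by apply: eq_bigr => i _; rewrite scalerDr scalemxAl.
Qed.

Lemma vertex_weightE m (v : 'I_m.+1 -> E) a i : injective v ->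
  vertex_weight v a (v i) = a i.
Proof.
move=> vI; rewrite /vertex_weight (eq_bigl (pred1 i)) ?big_pred1_eq// => j /=.
by rewrite (inj_eq vI).
Qed.

Lemma vertex_weight_out m (v : 'I_m.+1 -> E) a w : (forall i, v i != w) ->
  vertex_weight v a w = 0.
Proof. by move=> vw; rewrite /vertex_weight big_pred0// => i; apply/negbTE. Qed.

Section Parametrisation.
Context {m n : nat} (v : 'I_m.+1 -> E) (e : 'I_n.+1 -> 'rV[R]_n).
Context (A : 'M[R]_(n, D)) (b : E).
Hypothesis Ap : affine_parametrisation e A b (open_simplex v).

Lemma parametrisation_closed_simplex :
  closed_simplex v = closed_simplex (fun i => e i *m A + b).
Proof.
case: Ap => _; rewrite !closure_open_simplex => -[fun_f _ surj_f].
apply/seteqP; split=> [x /surj_f[_ [a aw ->] <-]|_ [a aw ->]].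
  by exists a => //; rewrite affine_combination//; case: aw.
by rewrite -affine_combination; [apply: fun_f; exists a|case: aw].
Qed.

(* A relation among the images would identify the barycentre with a nearby point of
   the regular simplex. *)
Lemma parametrisation_independent : no_affine_relation (fun i => e i *m A + b).
Proof.
case: Ap => eR; rewrite !closure_open_simplex => -[_ inj_f _] c c0 cf.
have eA := regular_no_affine_relation eR.
pose N : R := n.+1%:R; pose M : R := 1 + \sum_i `|c i|.
have N0 : 0 < N by rewrite ltr0n.
have cM i : `|c i| <= M.
  by rewrite /M (bigD1 i)//= addrCA lerDl addr_ge0// sumr_ge0.
have M0 : 0 < M by rewrite ltr_pwDl// sumr_ge0.
(* The factor 1 / (N M) keeps these weights nonnegative, as |c_i| <= M. *)
pose a i := N^-1 + (N * M)^-1 * c i.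
have NN : \sum_(i < n.+1) N^-1 = 1.
  by rewrite sumr_const card_ord -[LHS]mulr_natl divff ?gt_eqF.
have aw : convex_weights a.
  split=> [i|]; last by rewrite big_split/= -mulr_sumr c0 mulr0 addr0.
  have -> : a i = (N * M)^-1 * (M + c i) by rewrite /a; field; rewrite !gt_eqF.
  rewrite mulr_ge0 ?invr_ge0 ?mulr_ge0 ?(ltW N0) ?(ltW M0)//.
  by have := cM i; rewrite ler_norml => /andP[+ _]; lra.
have Nw : convex_weights (fun _ : 'I_n.+1 => N^-1).
  by split=> // i; rewrite invr_ge0 ltW.
have : \sum_i a i *: e i = \sum_i N^-1 *: e i.
  apply: inj_f; rewrite ?inE; [by exists a|by exists (fun=> N^-1)|].
  rewrite !affine_combination ?aw.2//.
  transitivity (\sum_i N^-1 *: (e i *m A + b) +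
      (N * M)^-1 *: (\sum_i c i *: (e i *m A + b))); last by rewrite cf scaler0 addr0.
  rewrite scaler_sumr -big_split/=.
  by apply: eq_bigr => i _; rewrite scalerDl scalerA.
move=> /(affine_coord_inj eA); rewrite aw.2 NN => /(_ erefl) aN i.
have /eqP := congr1 (fun f => f i) aN.
have NM : (N * M)^-1 != 0 by rewrite invr_eq0 gt_eqF// mulr_gt0.
by rewrite /a -subr_eq0 addrAC subrr add0r mulf_eq0 (negPf NM) => /eqP.
Qed.

End Parametrisation.

Lemma parametrisation_exists m (v : 'I_m.+1 -> E) : no_affine_relation v ->
  exists (e : 'I_m.+1 -> 'rV[R]_m) (A : 'M[R]_(m, D)) (b : E),
    affine_parametrisation e A b (open_simplex v).
Proof.
move=> vA; have [e [eR /(_ D v)[A [b eAb]]]] := regular_simplex_exists (R := R) m.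
have eE a : \sum_i a i = 1 -> (\sum_i a i *: e i) *m A + b = \sum_i a i *: v i.
  by move=> a1; rewrite affine_combination//; apply: eq_bigr => i _; rewrite eAb.
exists e, A, b; split=> //; rewrite !closure_open_simplex; split.
- by move=> _ [a aw ->]; exists a => //; rewrite eE//; case: aw.
- move=> x y; rewrite !inE => -[a [_ a1] ->] [c [_ c1] ->]; rewrite !eE//.
  by move/(affine_coord_inj vA); rewrite a1 c1 => ->.
- by move=> _ [a aw ->]; exists (\sum_i a i *: e i); [exists a|rewrite eE//; case: aw].
Qed.

(** A parametrisation carries vertices to vertices, so coordinates can be read in the regular
    simplex, where 2 d^2 is the sum of the squared differences. A single term gives the first bound;
    the at most D + 1 terms together give the second. *)
Lemma simplex_dist_bounds m (v : 'I_m.+1 -> E) a b :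
  no_affine_relation v -> convex_weights a -> convex_weights b ->
  let d := simplex_dist (open_simplex v) (\sum_i a i *: v i) (\sum_i b i *: v i) in
  (forall w, `|vertex_weight v a w - vertex_weight v b w| <= 2 * d) /\
  (forall eps, (forall w, `|vertex_weight v a w - vertex_weight v b w| <= eps) ->
    d <= D.+1%:R * eps).
Proof.
move=> vA aw bw /=; rewrite /simplex_dist.
set P := (X in xget 0 X).
(* Since a parametrisation exists, [xget] returns an actual distance and not its default 0. *)
have /(xgetPex 0) : exists d, P d.
  have [e [A [c Ap]]] := parametrisation_exists vA.
  have [_ [_ _ surj_f]] := Ap; rewrite !closure_open_simplex in surj_f.
  have [p pe fp] := surj_f _ (ex_intro2 _ _ a aw erefl).
  have [q qe fq] := surj_f _ (ex_intro2 _ _ b bw erefl).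
  by exists (enorm (p - q)), m, e, A, c, p, q; rewrite closure_open_simplex.
move: (xget 0 P) => d [n [e [A [c [p [q [Ap [pe ap] [qe bq] dE]]]]]]].
have [eR _] := Ap.
move: pe qe; rewrite closure_open_simplex => -[al alw pE] [be bew qE].
have uA := parametrisation_independent Ap.
have vu := parametrisation_closed_simplex Ap.
have wa : vertex_weight v a = vertex_weight (fun i => e i *m A + c) al.
  apply: vertex_weight_unique => //; first by rewrite aw.2 alw.2.
  by rewrite ap pE affine_combination// alw.2.
have wb : vertex_weight v b = vertex_weight (fun i => e i *m A + c) be.
  apply: vertex_weight_unique => //; first by rewrite bw.2 bew.2.
  by rewrite bq qE affine_combination// bew.2.
rewrite wa wb; move: uA; set u := (fun i => _ : E) => uA.
have uI := no_affine_relation_inj uA.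
have nD : (n <= D)%N by apply: affinely_independent_dim; apply/affinely_independentP/uA.
have d0 : 0 <= d by rewrite dE enorm_ge0.
have dd : 2 * d ^+ 2 = \sum_i (al i - be i) ^+ 2.
  rewrite -(enorm_regular eR); last by rewrite sumrB alw.2 bew.2 subrr.
  rewrite dE pE qE -sumrB; congr (2 * enorm _ ^+ 2).
  by apply: eq_bigr => i _; rewrite scalerBl.
split=> [w|eps H].
  have [[i <-]|nw] := pselect (exists i, u i = w).
    rewrite !vertex_weightE//.
    rewrite -(@ler_pXn2r _ 2) ?nnegrE ?mulr_ge0// real_normK ?num_real//.
    apply: (@le_trans _ _ (2 * d ^+ 2)); last by rewrite exprMn; have := sqr_ge0 d; lra.
    by rewrite dd (bigD1 i)//= lerDl sumr_ge0// => j _; rewrite sqr_ge0.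
  have uw i : u i != w by apply/eqP => ui; apply: nw; exists i.
  by rewrite !vertex_weight_out// subrr normr0 mulr_ge0.
have eps0 : 0 <= eps by apply: le_trans (H 0).
rewrite -(@ler_pXn2r _ 2) ?nnegrE ?mulr_ge0//.
apply: (@le_trans _ _ (2 * d ^+ 2)); first by have := sqr_ge0 d; lra.
rewrite dd; apply: (@le_trans _ _ (\sum_(i < n.+1) eps ^+ 2)).
  apply: ler_sum => i _; have := H (u i); rewrite !vertex_weightE// => Hi.
  by rewrite -real_normK ?num_real// ler_pXn2r ?nnegrE.
rewrite sumr_const card_ord -[leLHS]mulr_natl exprMn ler_wpM2r ?sqr_ge0//.
by rewrite -natrX ler_nat expnS (leq_trans (_ : _ <= D.+1)%N)// leq_pmulr.
Qed.

End SimplexDist.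

(** * The metric of a complex *)

Section Complex.
Context {R : realType} {D : nat} (K : set (set 'rV[R]_D)).
Local Notation E := 'rV[R]_D.
Hypothesis KS : simplicial_complex K.

Definition is_barycentric (x : E) (f : E -> R) : Prop :=
  exists m (v : 'I_m.+1 -> E) a, [/\ affinely_independent v, K (open_simplex v),
    convex_weights a, x = \sum_i a i *: v i & f = vertex_weight v a].

(** Two closed simplices containing [x] meet in a common closed face, and the coordinates in either
    are those in the face, extended by 0. *)
Lemma is_barycentric_unique x f g :
  is_barycentric x f -> is_barycentric x g -> f = g.
Proof.
move=> [m [v [a [vA Kv aw xv ->]]]] [n [u [b [uA Ku bw xu ->]]]].
have vx : closed_simplex v x by exists a.
have ux : closed_simplex u x by exists b.
case: (complex_inter KS Kv Ku) => [|[F [vF uF]]]; rewrite !closure_open_simplex.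
  by move=> /seteqP[/(_ x (conj vx ux))].
move=> vuF; have Fx : closure F x by rewrite -vuF.
(* [is_face] may use another enumeration [v'] of the vertices, so coordinates pass from [w] to [v']
   and only then to the face. *)
have face_weight k (w : 'I_k.+1 -> E) c : affinely_independent w ->
    convex_weights c -> x = \sum_i c i *: w i -> is_face F (open_simplex w) ->
    exists l (w' : 'I_l.+1 -> E) c', [/\ no_affine_relation w',
      closed_simplex w' = closure F, \sum_i c' i = 1, x = \sum_i c' i *: w' i
      & vertex_weight w c = vertex_weight w' c'].
  move=> /affinely_independentP wA cw xw [m' [v' [l [h [v'A wv' hI FE]]]]].
  have v'R := iffLR (affinely_independentP _) v'A.
  move: (Fx); rewrite FE closure_open_simplex => -[c' c'w xc'].
  exists l, (v' \o h), c'; split=> //.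
  - exact: no_affine_relation_comp.
  - by case: c'w.
  have wv : closed_simplex w = closed_simplex v' by rewrite -!closure_open_simplex wv'.
  have [d dw xd] : closed_simplex v' x by rewrite -wv; exists c.
  transitivity (vertex_weight v' d).
    by apply: vertex_weight_unique => //; rewrite ?cw.2 ?dw.2 -?xw.
  apply/esym; apply: (@vertex_weight_push _ _ _ v' v'R _ (v' \o h) h) => //.
    by rewrite c'w.2 dw.2.
  by rewrite -xc'.
have [l [w [c [wA wF c1 xc ->]]]] := face_weight _ _ _ vA aw xv vF.
have [l' [w' [c' [wA' wF' c1' xc' ->]]]] := face_weight _ _ _ uA bw xu uF.
by apply: vertex_weight_unique; rewrite ?wF ?wF' ?c1 ?c1' -?xc.
Qed.

Lemma is_barycentric_exists x : polyhedron K x -> exists f, is_barycentric x f.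
Proof.
move=> [S KSS Sx]; have [m [v [vA SE]]] := complex_simplex KS KSS.
move: Sx; rewrite SE => -[a [a0 a1 xE]].
exists (vertex_weight v a), m, v, a; split=> //; first by rewrite -SE.
by split=> // i; rewrite ltW.
Qed.

(** Dropping the vertices of weight 0 puts the point in an open face, which belongs to [K]. *)
Lemma closed_simplex_polyhedron m (v : 'I_m.+1 -> E) :
  affinely_independent v -> K (open_simplex v) ->
  closed_simplex v `<=` polyhedron K.
Proof.
move=> vA Kv _ [a [a0 a1] ->].
pose A := [set i | a i != 0]%SET.
have A0 : (0 < #|A|)%N.
  rewrite card_gt0; apply/negP => /eqP A0.
  move: a1; rewrite big1 => [/eqP|i _]; first by rewrite eq_sym oner_eq0.
  by apply/eqP; move/setP: A0 => /(_ i); rewrite !inE => /negbT; rewrite negbK.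
have lE : #|A|.-1.+1 = #|A| by rewrite prednK.
pose f i : 'I_m.+1 := enum_val (cast_ord lE i).
have fI : injective f by move=> i j /enum_val_inj/cast_ord_inj.
have fsum (U : nmodType) (F : 'I_m.+1 -> U) : (forall i, a i = 0 -> F i = 0) ->
    \sum_i F i = \sum_j F (f j).
  move=> F0; rewrite (bigID (mem A))/= [X in _ + X]big1 ?addr0; last first.
    by move=> i; rewrite inE negbK => /eqP/F0.
  rewrite big_enum_val/= (reindex (cast_ord lE))//.
  by apply: onW_bij; exact: (Bijective (cast_ordK lE) (cast_ordKV lE)).
exists (open_simplex (v \o f)).
  by apply: (complex_face KS Kv); exists m, v, _, f.
exists (a \o f); split=> /=.
- move=> i; rewrite lt_def a0 andbT.
  by have := enum_valP (cast_ord lE i); rewrite inE.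
- by rewrite -a1 -fsum.
- by rewrite fsum// => i ->; rewrite scale0r.
Qed.

Definition barycentric (x : E) : E -> R := xget (fun=> 0) (is_barycentric x).

Lemma barycentricE m (v : 'I_m.+1 -> E) a :
  affinely_independent v -> K (open_simplex v) -> convex_weights a ->
  barycentric (\sum_i a i *: v i) = vertex_weight v a.
Proof.
move=> vA Kv aw; have xv : is_barycentric (\sum_i a i *: v i) (vertex_weight v a).
  by exists m, v, a.
exact: is_barycentric_unique (xgetI _ xv) xv.
Qed.

Lemma barycentric_chart_exists x : polyhedron K x ->
  exists m (v : 'I_m.+1 -> E), [/\ affinely_independent v, K (open_simplex v),
    carried_by v (barycentric x), convex_weights (barycentric x \o v)
    & x = \sum_i barycentric x (v i) *: v i].
Proof.
move=> /is_barycentric_exists[_ [m [v [a [vA Kv aw xE _]]]]].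
have xv : barycentric x = vertex_weight v a by rewrite {1}xE barycentricE.
have xa i : barycentric x (v i) = a i.
  by rewrite xv vertex_weightE//; exact/no_affine_relation_inj/affinely_independentP.
exists m, v; split=> //.
- by move=> w vw; rewrite xv vertex_weight_out.
- split=> [i|]; first by rewrite /= xa; case: aw.
  by rewrite -aw.2; apply: eq_bigr => i _; exact: xa.
- by rewrite [LHS]xE; apply: eq_bigr => i _; rewrite xa.
Qed.

Lemma barycentric_ge0 x w : polyhedron K x -> 0 <= barycentric x w.
Proof.
move=> /barycentric_chart_exists[m [v [_ _ xv [x0 _] _]]].
have [[i <-]|nw] := pselect (exists i, v i = w); first exact: x0.
by rewrite xv// => i; apply/eqP => vi; apply: nw; exists i.
Qed.

(** Both sums are known in some chart of [x], and [carried_by_total] moves them to [v]. *)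
Lemma barycentric_carried x m (v : 'I_m.+1 -> E) :
  polyhedron K x -> injective v -> carried_by v (barycentric x) ->
  convex_weights (barycentric x \o v) /\ x = \sum_i barycentric x (v i) *: v i.
Proof.
move=> Kx vI cv; have [n [u [uA _ cu [_ u1] xu]]] := barycentric_chart_exists Kx.
have uI : injective u by exact/no_affine_relation_inj/affinely_independentP.
split.
  split=> [i|]; first exact: barycentric_ge0.
  by rewrite -[RHS]u1; exact: (carried_by_total (f := barycentric x)).
rewrite [LHS]xu; apply: (carried_by_total (f := fun w => barycentric x w *: w)) => //.
  by move=> w /cu ->; rewrite scale0r.
by move=> w /cv ->; rewrite scale0r.
Qed.

Lemma simplex_dist_ge S x y w : K S -> closure S x -> closure S y ->
  `|barycentric x w - barycentric y w| <= 2 * simplex_dist S x y.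
Proof.
move=> KSS; have [m [v [vA SE]]] := complex_simplex KS KSS.
rewrite SE in KSS *; rewrite !closure_open_simplex => -[a aw ->] [b bw ->].
rewrite !barycentricE//.
by have [] := simplex_dist_bounds (iffLR (affinely_independentP _) vA) aw bw.
Qed.

(** The coordinates are defined on the whole polyhedron, so the bounds for single steps add up
    whichever simplices the chain crosses. *)
Lemma chain_length_ge x y n p S w : is_chain K x y n p S ->
  `|barycentric x w - barycentric y w| <=
    2 * \sum_(j < n) simplex_dist (S j) (p j) (p j.+1).
Proof.
case=> <- <- _; elim: n => [|n IHn] H; first by rewrite big_ord0 subrr normr0 mulr0.
rewrite big_ord_recr/= mulrDr (le_trans (ler_distD (barycentric (p n) w) _ _))//.
rewrite lerD ?IHn//; first by move=> j jn; apply: H; rewrite ltnW.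
by have [KSn Sn Sn1] := H n (ltnSn n); exact: simplex_dist_ge.
Qed.

Lemma chain_extend x y z n p S T : is_chain K x y n p S ->
  K T -> closure T y -> closure T z -> polyhedron K z ->
  exists p' S', is_chain K x z n.+1 p' S'.
Proof.
move=> [px py Kp HS] KT Ty Tz Kz.
exists (fun j => if (j <= n)%N then p j else z).
exists (fun j => if (j < n)%N then S j else T).
split=> //; first by rewrite ltnn.
- by move=> j _; case: ifP => // /Kp.
move=> j; rewrite ltnS => jn; rewrite jn.
case: ltnP => [/HS//|nj]; have -> : j = n by apply/eqP; rewrite eqn_leq jn.
by rewrite py.
Qed.

(* Local finiteness: all but finitely many simplices keep away from [x], and the
   remaining ones whose closure misses [x] can be avoided. *)
Lemma near_common_simplex x : polyhedron K x ->
  \forall z \near x, polyhedron K z -> exists T, [/\ K T, closure T x & closure T z].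
Proof.
move=> Kx; have [U Ux Ufin] := complex_locally_finite KS Kx.
pose P := [set S | (K S /\ S `&` U !=set0) /\ ~ closure S x].
have Pfin : finite_set P by apply: sub_finite_set Ufin => S [].
have Pn : nbhs x (~` \bigcup_(S in P) closure S).
  apply: open_nbhs_nbhs; split; last by move=> [S [_ nSx] /nSx].
  by rewrite openC; apply: closed_bigcup => // S _; exact: closed_closure.
near=> z => -[S KSS Sz].
have Uz : U z by near: z.
have Pz : (~` \bigcup_(S in P) closure S) z by near: z.
have clSz : closure S z by exact: subset_closure.
exists S; split=> //; apply: contrapT => nSx; apply: Pz.
by exists S => //; split=> //; split=> //; exists z.
Unshelve. all: by end_near. Qed.

Hypothesis KC : connected_complex K.

(** Points of [V z] share a closed simplex with [z], so they are reachable exactly when [z] is;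
    reachability is thus open and closed. It makes the infimum in [complex_dist] one over a nonempty
    set. *)
Lemma chain_exists x y : polyhedron K x -> polyhedron K y ->
  exists n p S, is_chain K x y n p S.
Proof.
move=> Kx Ky.
pose B := [set z | polyhedron K z /\ exists n p S, is_chain K x z n p S].
pose V z := [set t | polyhedron K t -> exists T, [/\ K T, closure T z & closure T t]]^°.
have Vz z : polyhedron K z -> V z z.
  by move=> /near_common_simplex Hz; exact: nbhs_singleton (nbhs_interior Hz).
have VB z t : polyhedron K z -> polyhedron K t -> V z t -> B z <-> B t.
  move=> Kz Kt /interior_subset/(_ Kt)[T [KT Tz Tt]].
  split=> -[_ [n [p [S pS]]]]; split=> //; exists n.+1.
    by have [p' [S' ?]] := chain_extend pS KT Tz Tt Kt; exists p', S'.
  by have [p' [S' ?]] := chain_extend pS KT Tt Tz Kz; exists p', S'.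
suff BK : B = polyhedron K by have [] : B y by rewrite BK.
apply: KC.
- exists x; split=> //; exists 0%N, (fun=> x), (fun=> set0); split=> //.
- exists (\bigcup_(z in B) V z).
    by apply: bigcup_open => z _; exact: open_interior.
  apply/seteqP; split=> [z Bz|z [Kz [t Bt Vt]]].
    by split; [case: Bz|exists z => //; apply: Vz; case: Bz].
  by apply/(VB t z) => //; case: Bt.
- exists (~` \bigcup_(z in polyhedron K `\` B) V z).
    by apply: open_closedC; apply: bigcup_open => z _; exact: open_interior.
  apply/seteqP; split=> [z Bz|z [Kz nz]].
    split; first by case: Bz.
    by move=> [t [Kt nt] Vt]; apply: nt; apply/(VB t z) => //; case: Bz.
  by apply: contrapT => nBz; apply: nz; exists z => //; exact: Vz.
Qed.

Lemma complex_dist_ge x y w : polyhedron K x -> polyhedron K y ->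
  `|barycentric x w - barycentric y w| <= 2 * complex_dist K x y.
Proof.
move=> Kx Ky; rewrite -ler_pdivrMl//; apply: lb_le_inf.
  have [n [p [S pS]]] := chain_exists Kx Ky.
  by exists (\sum_(j < n) simplex_dist (S j) (p j) (p j.+1)), n, p, S.
move=> _ [n [p [S [pS ->]]]].
by rewrite ler_pdivrMl//; exact: chain_length_ge.
Qed.

Lemma complex_dist_le m (v : 'I_m.+1 -> E) a b eps :
  affinely_independent v -> K (open_simplex v) ->
  convex_weights a -> convex_weights b ->
  (forall w, `|vertex_weight v a w - vertex_weight v b w| <= eps) ->
  complex_dist K (\sum_i a i *: v i) (\sum_i b i *: v i) <= D.+1%:R * eps.
Proof.
move=> vA Kv aw bw Heps.
have [_ /(_ eps Heps)] :=
  simplex_dist_bounds (iffLR (affinely_independentP _) vA) aw bw.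
apply: le_trans; apply: ge_inf.
  (* Chain lengths are nonnegative because twice a length dominates an absolute value. *)
  exists 0 => _ [n [p [S [pS ->]]]].
  have := chain_length_ge 0 pS; move=> /(le_trans (normr_ge0 _)).
  by rewrite pmulr_rge0.
pose x := \sum_i a i *: v i; pose y := \sum_i b i *: v i.
have vx : closed_simplex v x by exists a.
have vy : closed_simplex v y by exists b.
exists 1%N, (fun j => if j == 0%N then x else y), (fun=> open_simplex v).
split; last by rewrite big_ord1.
split=> // [j _|j]; first by case: ifP => _; exact: (closed_simplex_polyhedron vA Kv).
by rewrite ltnS leqn0 => /eqP -> /=; rewrite closure_open_simplex.
Qed.

End Complex.

(** * Transport of the coordinates along the triangulation *)

Theorem lemma5p6 (R : realType) (X : metricType R) :
  admits_bilipschitz_triangulation X -> cube_decomposable X.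
Proof.
move=> [D [K [tau [KS KC tau_surj [L L0 tauL]]]]].
have [g gK] := choice tau_surj.
pose lam x := barycentric K (\val (g x)).
have Kg x : polyhedron K (\val (g x)) by exact: set_valP.
(* [g] is only a section of [tau], but [g (tau p)] and [p] have the same image, hence distance at
   most 0 and equal coordinates. *)
have lamK (p : polyhedron K) : lam (tau p) = barycentric K (\val p).
  apply/funext => w; apply/eqP; rewrite -subr_eq0 -normr_le0.
  rewrite (le_trans (complex_dist_ge KS KC _ (Kg _) (set_valP p)))//.
  have [+ _] := tauL (g (tau p)) p.
  by rewrite gK mdistxx ler_pdivrMl// mulr0; lra.
(* One constant for both directions: 2 L for the coordinates as functions of the point, L (D + 1)
   for distances within a simplex. *)
pose M := 2 * L + L * D.+1%:R.
have LD : 0 < L * D.+1%:R by rewrite mulr_gt0.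
have M0 : 0 < M by rewrite /M; lra.
apply: (@cube_decomposable_of_coordinates _ X _ lam D M M0).
- by move=> x w; exact: barycentric_ge0.
- move=> x y w; rewrite (le_trans (complex_dist_ge KS KC _ (Kg x) (Kg y)))//.
  have [+ _] := tauL (g x) (g y); rewrite !gK ler_pdivrMl// => xy.
  have LDxy := mulr_ge0 (ltW LD) (mdist_ge0 x y).
  by rewrite /M mulrDl; lra.
move=> x; have [m [v [vA Kv cx [_ x1] _]]] := barycentric_chart_exists KS (Kg x).
have vI : injective v by exact/no_affine_relation_inj/affinely_independentP.
exists m, v; split; first exact: affinely_independent_dim vA.
split=> // [b b0 b1|y z e cy cz yz].
  have Kb : polyhedron K (\sum_i b i *: v i).
    by apply: (closed_simplex_polyhedron KS vA Kv); exists b.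
  exists (tau (SigSub (mem_set Kb))); rewrite lamK /= barycentricE//.
    by move=> w vw; exact: vertex_weight_out.
  by move=> i; exact: vertex_weightE.
have e0 : 0 <= e by apply: le_trans (yz 0).
have [yw yE] := barycentric_carried KS (Kg y) vI cy.
have [zw zE] := barycentric_carried KS (Kg z) vI cz.
have lamv y' : carried_by v (lam y') -> vertex_weight v (lam y' \o v) = lam y'.
  by move=> cy'; apply/funext => w; exact: carried_by_sum.
have [_ tauyz] := tauL (g y) (g z); move: tauyz; rewrite !gK => /le_trans; apply.
rewrite yE zE (@le_trans _ _ (L * (D.+1%:R * e)))//.
  rewrite ler_pM2l//; apply: (complex_dist_le KS vA Kv yw zw) => w.
  by rewrite !lamv.
rewrite mulrA ler_wpM2r// /M; lra.
Qed.
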